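(* Let $s\geq 1$ be an integer and $k=2s$. For $1\leq i\leq s$ let $P_{i}(X)\in\mathbb{Z}[X]$ be a polynomial with integral coefficients in one variable of degree $d_{i}\geq 1$. Let $d:=\min_{1\leq i\leq s}d_{i}$ and $d^{\prime}:=\max_{1\leq i\leq s}d_{i}$. Define $$M=\left\{(x_{1},x_{2},\ldots,x_{s},P_{1}(x_{1}),\ldots,P_{s}(x_{s}))\in\mathbb{R}^{k}:(x_{1},\ldots,x_{s})\in\mathbb{R}^{s}\right\}.$$ Then for every $\lambda>\max\{d^{\prime}-1,1\}$, $$\Pi_{s}(\mathscr{H}^{k}_{\lambda}\cap M)\subseteq\mathscr{H}^{s}_{d\lambda+d-1}.$$ In particular, for every $\lambda>\max\{d^{\prime}-1,1\}$, $$\dim(\mathscr{H}^{k}_{\lambda}\cap M)\leq\frac{s+1}{d(\lambda+1)}.$$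
   Context: $\dim$ denotes Hausdorff dimension. For a real number $x$, $\Vert x\Vert$ denotes the distance of $x$ to the nearest integer. For an integer $m\geq 1$ and a real parameter $\lambda>0$, $\mathscr{H}^{m}_{\lambda}$ is the set of $(\zeta_{1},\ldots,\zeta_{m})\in\mathbb{R}^{m}$ such that for every fixed $\epsilon>0$ the estimate $\max_{1\leq j\leq m}\Vert q\zeta_{j}\Vert\leq q^{-\lambda+\epsilon}$ has arbitrarily large (positive) integer solutions $q$. $\Pi_{s}:\mathbb{R}^{k}\to\mathbb{R}^{s}$ is the projection onto the first $s$ coordinates. *)

(* Defs.v *)
From HB Require Import structures.
From mathcomp Require Import all_boot all_order all_algebra.
From mathcomp Require Import all_classical all_reals all_analysis.

Set Implicit Arguments.
Unset Strict Implicit.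
Unset Printing Implicit Defensive.
Import Order.TTheory GRing.Theory Num.Theory.
Import numFieldNormedType.Exports.
Local Open Scope classical_set_scope.
Local Open Scope ring_scope.

Definition dist_int (R : realType) (x : R) : R :=
  inf [set `|x - a%:~R| | a in [set: int]].

(* All distances are nonnegative, so the neutral element 0 does not affect the
   maximum.  The condition N < q both forces q > 0 and makes q arbitrarily
   large. *)
Definition simul_approx (R : realType) (m : nat) (lam : R) : set 'rV[R]_m :=
  [set z : 'rV[R]_m | forall eps : R, 0 < eps -> forall N : nat, exists q : nat,
     (N < q)%N /\
     \big[Num.max/0]_(j < m) dist_int (q%:R * z 0 j)
       <= q%:R `^ (- lam + eps)].

(* The library norm on row vectors is the sup norm, so the Euclidean distance
   is spelled out. *)
Definition eucl_dist (R : realType) (n : nat) (x y : 'rV[R]_n) : R :=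
  Num.sqrt (\sum_(j < n) (x 0 j - y 0 j) ^+ 2).

(* The singleton [set 0] gives the empty set diameter 0 instead of -oo. *)
Definition diam (R : realType) (n : nat) (U : set 'rV[R]_n) : \bar R :=
  ereal_sup ([set 0%E] `|` [set (eucl_dist x y)%:E | x in U & y in U]).

(* The empty set contributes 0 even for t = 0, where powers of 0 are 1; hence
   covers by sequences include finite covers. *)
Definition hausdorff_gauge (R : realType) (n : nat) (t : R)
    (U : set 'rV[R]_n) : \bar R :=
  if U == set0 then 0%E else poweR (diam U) t.

Definition hausdorff_content (R : realType) (n : nat) (t delta : R)
    (A : set 'rV[R]_n) : \bar R :=
  ereal_inf [set (\sum_(i <oo) hausdorff_gauge t (U i))%E |
    U in [set U : nat -> set 'rV[R]_n |
      A `<=` \bigcup_i U i /\ forall i, (diam (U i) <= delta%:E)%E]].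

Definition hausdorff_measure (R : realType) (n : nat) (t : R)
    (A : set 'rV[R]_n) : \bar R :=
  ereal_sup [set hausdorff_content t delta A | delta in [set delta : R | 0 < delta]].

Definition hausdorff_dim (R : realType) (n : nat) (A : set 'rV[R]_n) : \bar R :=
  ereal_inf [set t%:E | t in [set t : R | 0 <= t /\ hausdorff_measure t A = 0%E]].

Definition degree (p : {poly int}) : nat := (size p).-1.

Definition max_degree (s : nat) (P : 'I_s -> {poly int}) : nat :=
  \max_(i < s) degree (P i).

(* nat has no greatest element; starting from the maximum gives the minimum of
   the degrees as soon as 0 < s. *)
Definition min_degree (s : nat) (P : 'I_s -> {poly int}) : nat :=
  \big[Order.min/max_degree P]_(i < s) degree (P i).

Definition poly_graph (R : realType) (s : nat) (P : 'I_s -> {poly int}) :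
    set 'rV[R]_(s + s) :=
  [set row_mx x (\row_(i < s) (map_poly intr (P i)).[x 0 i]) |
    x in [set: 'rV[R]_s]].
Arguments poly_graph R [s] P.
Arguments simul_approx {R} m%_N lam.

(* Main.v *)
(* If q is a simultaneous denominator for x and P(x) with quality lam > d' - 1,
   and p_i is the integer nearest to q x_i, then q P_i(p_i / q) is within
   O(q^(-lam)) of an integer while its denominator divides q^(deg P_i - 1), so it
   is an integer.  In lowest terms p_i / q = a_i / b_i, this forces b_i^(deg P_i)
   to divide q up to a constant, hence the least common multiple b of the b_i
   satisfies b^d = O(q), and b approximates x with exponent d lam + d - 1.  The
   dimension bound follows from the covering of the set of such x by balls around
   rational points, lifted to the graph by a locally Lipschitz map. *)
Require Import Defs.
From HB Require Import structures.
From mathcomp Require Import all_boot all_order all_algebra.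
From mathcomp Require Import all_classical all_reals all_analysis.
From mathcomp Require Import ring lra zify.

Set Implicit Arguments.
Unset Strict Implicit.
Unset Printing Implicit Defensive.
Import Order.TTheory GRing.Theory Num.Theory.
Import numFieldNormedType.Exports.
Local Open Scope classical_set_scope.
Local Open Scope ring_scope.

(** * Divisibility: powers of least common multiples and denominators of polynomial values *)

(** With [g] the gcd, the lcm is [(a/g) (b/g) g] with coprime cofactors; once [g ^ d] is cancelled,
    the powers of the cofactors stay coprime and Gauss's lemma applies. *)
Lemma dvdn_lcm_exp (a b d n : nat) : (0 < a)%N ->
  (a ^ d %| n)%N -> (b ^ d %| n)%N -> (lcmn a b ^ d %| n)%N.
Proof.
move=> a0 an bn; pose g := gcdn a b.
have g0 : (0 < g)%N by rewrite gcdn_gt0 a0.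
have aE : a = ((a %/ g) * g)%N by rewrite divnK // dvdn_gcdl.
have bE : b = ((b %/ g) * g)%N by rewrite divnK // dvdn_gcdr.
have cop : coprime (a %/ g) (b %/ g).
  rewrite /coprime -(eqn_pmul2r g0) muln_gcdl mul1n.
  by rewrite -aE -bE.
have -> : lcmn a b = ((a %/ g) * (b %/ g) * g)%N.
  apply/eqP; rewrite -(eqn_pmul2r g0) muln_lcm_gcd.
  by rewrite {1}aE {1}bE; apply/eqP; ring.
move: an bn; rewrite {1}aE {1}bE !expnMn => an bn.
have gd0 : (0 < g ^ d)%N by rewrite expn_gt0 g0.
have /dvdnP[m nE] : (g ^ d %| n)%N := dvdn_trans (dvdn_mull _ (dvdnn _)) an.
move: an bn; rewrite nE !dvdn_pmul2r // => an bn.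
by rewrite Gauss_dvd ?an //; exact/coprimeXl/coprimeXr.
Qed.

Lemma dvdn_biglcm_exp (I : finType) (b : I -> nat) (d n : nat) :
  (forall i, 0 < b i)%N -> (forall i, (b i ^ d %| n)%N) ->
  ((\big[lcmn/1%N]_i b i) ^ d %| n)%N.
Proof.
move=> b0 bn; suff [] : (0 < \big[lcmn/1%N]_i b i)%N /\
  ((\big[lcmn/1%N]_i b i) ^ d %| n)%N by [].
elim/big_rec : _ => [|i m _ [m0 mn]]; first by rewrite exp1n dvd1n.
by rewrite lcmn_gt0 b0 m0; split => //; exact: dvdn_lcm_exp.
Qed.

(* Bezout gives [c = u b] modulo [N = c a^d + b M], hence
   [c^d = (u b)^d] modulo [N]. *)
Lemma dvdz_exp_lead (a b c M q : int) (d : nat) : coprimez a b ->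
  (b ^+ d %| q * (c * a ^+ d + b * M))%Z -> (b ^+ d %| q * c ^+ d)%Z.
Proof.
move=> cop; set N := (X in (_ %| q * X)%Z) => bqN.
have /coprimezP[[u v] /= uv] : coprimez (a ^+ d) b by rewrite coprimezXl.
pose w := c * v - u * M.
have cE : c = u * N + b * w.
  transitivity (c * (u * a ^+ d + v * b)); first by rewrite uv mulr1.
  by rewrite /N /w; ring.
have -> : q * c ^+ d = q * (c ^+ d - (b * w) ^+ d) + q * (b * w) ^+ d by ring.
rewrite rpredD //; last by rewrite exprMn mulrCA dvdz_mulr.
have cN : c - b * w = N * u by rewrite {1}cE; ring.
by rewrite subrXX cN !mulrA; do 2!apply: dvdz_mulr.
Qed.

(** The homogenization of [P]: it keeps [b ^ deg P * P(a / b)] inside the integers. *)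
Definition homog (P : {poly int}) (a b : int) : int :=
  \sum_(i < (degree P).+1) P`_i * a ^+ i * b ^+ (degree P - i).

Lemma homogZ (P : {poly int}) (g a b : int) :
  homog P (g * a) (g * b) = g ^+ degree P * homog P a b.
Proof.
rewrite /homog mulr_sumr; apply: eq_bigr => i _.
have -> : g ^+ degree P = g ^+ i * g ^+ (degree P - i).
  by rewrite -exprD subnKC // -ltnS.
by rewrite !exprMn; ring.
Qed.

Lemma homog_lead (P : {poly int}) (a b : int) :
  exists M, homog P a b = lead_coef P * a ^+ degree P + b * M.
Proof.
exists (\sum_(i < degree P) P`_i * a ^+ i * b ^+ (degree P - i.+1)).
rewrite /homog big_ord_recr /= subnn expr0 mulr1 addrC; congr (_ + _).
rewrite mulr_sumr; apply: eq_bigr => i _.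
by rewrite -[(_ - i)%N]subnSK // exprS; ring.
Qed.

Lemma homogE (F : numFieldType) (P : {poly int}) (a b : int) : b != 0 ->
  (homog P a b)%:~R =
  b%:~R ^+ degree P * (map_poly intr P).[a%:~R / b%:~R] :> F.
Proof.
move=> b0; have bF : (b%:~R : F) != 0 by rewrite intr_eq0.
rewrite (@horner_coef_wide _ (degree P).+1); last first.
  exact: leq_trans (size_poly _ _) (leqSpred _).
rewrite /homog rmorph_sum mulr_sumr; apply: eq_bigr => i _.
rewrite coef_map !rmorphM /= !rmorphXn /= expr_div_n.
have -> : (b%:~R : F) ^+ degree P = b%:~R ^+ i * b%:~R ^+ (degree P - i).
  by rewrite -exprD subnKC // -ltnS.
by field; rewrite expf_neq0.
Qed.

(* [q P(p/q)] has denominator dividing [q^(deg P - 1)], so it is an integer as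
   soon as it is closer to one than [q^(1 - deg P)]. *)
Lemma dvdn_reduced_denominator (F : numFieldType) (P : {poly int}) (q : nat)
    (p n : int) : (0 < q)%N -> (0 < degree P)%N ->
  `|q%:R * (map_poly intr P).[p%:~R / q%:R] - n%:~R| * q%:R ^+ (degree P).-1
    < 1 :> F ->
  ((q %/ gcdn `|p| q) ^ degree P %| q * `|lead_coef P| ^ degree P)%N.
Proof.
move=> q0 dP close; set d := degree P.
have qz : q%:Z != 0 by lia.
(* Both sides are integers, and [close] puts them at distance less than 1. *)
have homE : homog P p q = n * q%:Z ^+ d.-1.
  apply/eqP; rewrite -subr_eq0 -normr_eq0.
  suff : `|homog P p q - n * q%:Z ^+ d.-1| < 1 by lia.
  rewrite -(ltr_int F) intr_norm rmorphB rmorphM /= homogE // rmorphXn /=.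
  have -> : (q%:~R : F) ^+ degree P = q%:R * q%:R ^+ d.-1.
    by rewrite -exprS prednK.
  apply: le_lt_trans close.
  rewrite -[X in _ <= _ * X]ger0_norm ?exprn_ge0 ?ler0n // -normrM.
  by rewrite mulrBl mulrAC.
pose g := gcdn `|p| q; have g0 : (0 < g)%N by rewrite gcdn_gt0 q0 orbT.
have gz : g%:Z != 0 by lia.
pose b := (q %/ g)%N; pose a := (p %/ g)%Z.
have qE : q%:Z = g%:Z * b%:Z.
  by rewrite -PoszM mulnC divnK // dvdn_gcdr.
have pE : p = g%:Z * a.
  by rewrite mulrC divzK // dvdzE /= /g dvdn_gcdl.
have cop : coprimez a b.
  rewrite /coprimez; apply/eqP/(mulfI gz); rewrite mulr1.
  by rewrite (mulz_gcdr g) -pE -qE.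
suff : (b%:Z ^+ d %| q%:Z * lead_coef P ^+ d)%Z.
  by rewrite dvdzE abszM !abszX.
have [M homM] := homog_lead P a b.
apply: (dvdz_exp_lead (M := M) cop); rewrite -homM.
(* Homogeneity turns [homE] into [g ^ d * homog P a b = n * (g b) ^ (d - 1)]; multiplying by
   [b = q / g] gives this identity up to the factor [g ^ (d - 1)], which is cancelled. *)
suff -> : q%:Z * homog P a b = n * b%:Z ^+ d by rewrite dvdz_mull.
apply: (mulfI (expf_neq0 d.-1 gz)).
have dE : d = d.-1.+1 by rewrite prednK.
move: homE; rewrite pE qE homogZ -/d {1 3}dE !exprS exprMn => homE.
transitivity (b%:Z * (g%:Z * g%:Z ^+ d.-1 * homog P a b)); first by ring.
by rewrite homE {4}dE exprS; ring.
Qed.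

(** * Distance to the nearest integer; elementary real estimates *)

Lemma dist_int_has_inf (R : realType) (x : R) :
  has_inf [set `|x - a%:~R| | a in [set: int]].
Proof.
split; first by exists `|x - 0%:~R|; exists 0.
by exists 0 => _ [a _ <-].
Qed.

Lemma dist_int_le (R : realType) (x : R) (a : int) :
  dist_int x <= `|x - a%:~R|.
Proof. by apply: ge_inf; [case: (dist_int_has_inf x)|exists a]. Qed.

(** The floor of [x] or its successor is a nearest integer, so the infimum is a minimum. *)
Lemma dist_int_attained (R : realType) (x : R) :
  exists a : int, dist_int x = `|x - a%:~R|.
Proof.
pose f := Num.floor x.
have fx : f%:~R <= x := ge_floor x.
have xf : x < (f + 1)%:~R := floorD1_gt x.
have [a aP] : exists a : int, forall b : int, `|x - a%:~R| <= `|x - b%:~R|.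
  have key b : `|x - f%:~R| <= `|x - b%:~R| \/
               `|x - (f + 1)%:~R| <= `|x - b%:~R|.
    have [bf|fb] := leP b f; [left|right].
      have bfR : b%:~R <= f%:~R :> R by rewrite ler_int.
      by rewrite !ger0_norm; lra.
    have bfR : (f + 1)%:~R <= b%:~R :> R by rewrite ler_int -ltzD1 ltrD2r.
    by rewrite !ler0_norm; lra.
  have [h|h] := leP `|x - f%:~R| `|x - (f + 1)%:~R|.
    by exists f => b; case: (key b) => // h'; exact: le_trans h h'.
  by exists (f + 1) => b; case: (key b) => // h'; exact: le_trans (ltW h) h'.
exists a; apply/eqP; rewrite eq_le dist_int_le /=.
by apply: lb_le_inf => [|_ [b _ <-]//]; case: (dist_int_has_inf x).
Qed.

Lemma dist_int_ge0 (R : realType) (x : R) : 0 <= dist_int x.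
Proof. by have [a ->] := dist_int_attained x. Qed.

Lemma dist_intr (R : realType) (a : int) : dist_int (a%:~R : R) = 0.
Proof.
apply/eqP; rewrite eq_le dist_int_ge0 andbT.
by have := dist_int_le (a%:~R : R) a; rewrite subrr normr0.
Qed.

Lemma powRN_eventually_le (R : realType) (c e : R) : 0 < c -> 0 < e ->
  exists Q : nat, forall q : nat, (Q < q)%N -> q%:R `^ (- c) <= e.
Proof.
move=> c0 e0; exists (Num.truncn (e^-1 `^ c^-1)) => q Qq.
have q0 : (0 : R) < q%:R by rewrite ltr0n; exact: leq_ltn_trans Qq.
rewrite powRN -[e]invrK lef_pV2 ?posrE ?powR_gt0 ?invr_gt0 //.
have -> : e^-1 = (e^-1 `^ c^-1) `^ c.
  by rewrite -powRrM mulVf ?gt_eqF // powRr1 // invr_ge0 ltW.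
apply: ge0_ler_powR; rewrite ?nnegrE ?powR_ge0 ?(ltW c0) ?(ltW q0) //.
by apply: ltW; rewrite -truncn_lt_nat // powR_ge0.
Qed.

(** Induction along Horner's scheme. The term [|p(0)| + L B] bounds [|p(y)|], by the induction
    hypothesis between 0 and [y]. *)
Lemma poly_lipschitz (R : realType) (p : {poly R}) (B : R) :
  exists2 L, 0 <= L & forall x y, `|x| <= B -> `|y| <= B ->
    `|p.[x] - p.[y]| <= L * `|x - y|.
Proof.
elim/poly_ind: p => [|p c [L L0 IH]].
  by exists 0 => // x y _ _; rewrite !horner0 subrr normr0 mul0r.
have [B0|B0] := leP 0 B; last first.
  by exists 0 => // x y xB; have := normr_ge0 x; lra.
exists (L * B + (`|p.[0]| + L * B)); first by rewrite !addr_ge0 ?mulr_ge0.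
move=> x y xB yB.
have -> : (p * 'X + c%:P).[x] - (p * 'X + c%:P).[y] =
    (p.[x] - p.[y]) * x + p.[y] * (x - y) by rewrite !hornerE; ring.
apply: le_trans (ler_normD _ _) _; rewrite !normrM [leRHS]mulrDl.
apply: lerD.
  rewrite mulrAC; apply: ler_pM => //; exact: IH.
apply: ler_wpM2r => //.
rewrite -[p.[y]](subrK p.[0]) addrC; apply: le_trans (ler_normD _ _) _.
rewrite lerD2l; apply: le_trans (IH _ _ yB _) _; rewrite ?normr0 //.
by rewrite subr0 ler_wpM2l.
Qed.

Lemma poly_family_lipschitz (R : realType) (I : finType) (p : I -> {poly R})
    (B : R) :
  exists2 L, 0 <= L & forall i x y, `|x| <= B -> `|y| <= B ->
    `|(p i).[x] - (p i).[y]| <= L * `|x - y|.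
Proof.
have /choice[L LP] i : exists L, 0 <= L /\ forall x y, `|x| <= B -> `|y| <= B ->
    `|(p i).[x] - (p i).[y]| <= L * `|x - y|.
  by have [L] := poly_lipschitz (p i) B; exists L.
exists (\sum_i L i); first by apply: sumr_ge0 => i _; case: (LP i).
move=> i x y xB yB; apply: le_trans ((LP i).2 x y xB yB) _; apply: ler_wpM2r => //.
rewrite (bigD1 i) //= lerDl; apply: sumr_ge0 => j _; exact: (LP j).1.
Qed.

(** * A criterion for simultaneous approximability *)

(** A minimum of finitely many positive distances. It serves to exclude small denominators: an
    approximation better than [delta] forces [q > N]. *)
Lemma dist_int_multiples_lower_bound (R : realType) (m : nat) (z : 'rV[R]_m) :
  (forall q : nat, (0 < q)%N -> exists j, dist_int (q%:R * z 0 j) != 0) ->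
  forall N : nat, exists2 delta, 0 < delta &
    forall q : nat, (0 < q <= N)%N -> exists j, delta <= dist_int (q%:R * z 0 j).
Proof.
move=> nz; elim=> [|N [delta d0 IH]].
  by exists 1 => // q; case: q.
have [j jnz] := nz N.+1 isT.
exists (Num.min delta (dist_int (N.+1%:R * z 0 j))).
  by rewrite lt_min d0 lt_neqAle eq_sym jnz dist_int_ge0.
move=> q /andP[q0]; rewrite leq_eqVlt => /predU1P[->|qN].
  by exists j; rewrite ge_min lexx orbT.
have [|i iP] := IH q; first by rewrite q0.
by exists i; rewrite ge_min iP.
Qed.

(* If all denominators with small distance stayed bounded, one of them would
   make the point rational, and then its multiples are arbitrarily large. *)
Lemma simul_approx_suff (R : realType) (m : nat) (mu : R) (z : 'rV[R]_m) :
  (forall eps, 0 < eps -> exists K : R, forall delta : R, 0 < delta ->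
     exists2 q : nat, (0 < q)%N & forall j,
       dist_int (q%:R * z 0 j) <= delta /\
       dist_int (q%:R * z 0 j) <= K * q%:R `^ (- mu + eps)) ->
  simul_approx m mu z.
Proof.
move=> app eps eps0 N.
have [[q0 q00 qz]|nz] := pselect (exists2 q : nat, (0 < q)%N &
    forall j, dist_int (q%:R * z 0 j) = 0).
  exists (q0 * N.+1)%N; split; first by rewrite leq_pmull.
  apply: bigmax_le => [|j _]; rewrite ?powR_ge0 //.
  have [a aE] := dist_int_attained (q0%:R * z 0 j).
  move: aE; rewrite qz => /esym/eqP; rewrite normr_eq0 subr_eq0 => /eqP aE.
  rewrite natrM mulrAC aE (_ : _ * _ = (a * N.+1%:Z)%:~R) ?dist_intr ?powR_ge0 //.
  by rewrite rmorphM.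
have {}nz q : (0 < q)%N -> exists j, dist_int (q%:R * z 0 j) != 0.
  move=> q0; apply: contra_notP nz => h; exists q => // j.
  by apply/eqP/negPn/negP => jz; apply: h; exists j.
(* Half of [eps] goes into the hypothesis; the other half absorbs the constant, since
   [|K| + 1 <= q ^ (eps / 2)] for [q > Q]. *)
have e20 : 0 < eps / 2 by rewrite divr_gt0.
have [K app'] := app _ e20.
have [Q QP] := @powRN_eventually_le R _ (`|K| + 1)^-1 e20
  ltac:(by rewrite invr_gt0 ltr_wpDl).
have [delta d0 dP] := dist_int_multiples_lower_bound nz (maxn N Q).
have [q q0 qP] := app' (delta / 2) ltac:(by rewrite divr_gt0).
have qNQ : (maxn N Q < q)%N.
  rewrite ltnNge; apply/negP => qN; have [|j jd] := dP q; first by rewrite q0.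
  by have := le_trans jd (qP j).1; lra.
move: qNQ; rewrite gtn_max => /andP[Nq Qq].
exists q; split => //; apply: bigmax_le => [|j _]; rewrite ?powR_ge0 //.
apply: le_trans (qP j).2 _.
have qR : q%:R != 0 :> R by rewrite pnatr_eq0 -lt0n.
rewrite [in leRHS](_ : - mu + eps = eps / 2 + (- mu + eps / 2)); last by field.
rewrite [leRHS]powRD ?qR ?implybT // ler_wpM2r ?powR_ge0 //.
apply: le_trans (ler_norm K) _.
have K10 : 0 < `|K| + 1 by rewrite ltr_wpDl.
have qe0 : 0 < q%:R `^ (eps / 2) by rewrite powR_gt0 // ltr0n.
by have := QP _ Qq; rewrite powRN lef_pV2 ?posrE //; lra.
Qed.

Lemma distr_frac (R : realType) (x : R) (p : int) (q : nat) : (0 < q)%N ->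
  `|x - p%:~R / q%:R| = `|q%:R * x - p%:~R| / q%:R.
Proof.
move=> q0; have qR : q%:R != 0 :> R by rewrite pnatr_eq0 -lt0n.
have -> : x - p%:~R / q%:R = (q%:R * x - p%:~R) / q%:R by field.
by rewrite normrM normfV normr_nat.
Qed.

(** * The projection inclusion *)

Lemma degree_le_max (s : nat) (P : 'I_s -> {poly int}) (i : 'I_s) :
  (degree (P i) <= max_degree P)%N.
Proof. exact: leq_bigmax. Qed.

Lemma min_degree_le (s : nat) (P : 'I_s -> {poly int}) (i : 'I_s) :
  (min_degree P <= degree (P i))%N.
Proof. by rewrite -leEnat; exact: bigmin_le. Qed.

Lemma min_degree_gt0 (s : nat) (P : 'I_s -> {poly int}) : (0 < s)%N ->
  (forall i, 0 < degree (P i))%N -> (0 < min_degree P)%N.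
Proof.
move=> s0 P0; rewrite /min_degree.
elim/big_ind : _ => [|a b a0 b0|i _]; last exact: P0.
  exact: leq_trans (P0 (Ordinal s0)) (degree_le_max P _).
by rewrite /Order.min; case: ifP.
Qed.

(** Raising [b ^ d <= q C] to the power [e] converts a quality measured in [q] into one measured in
    the new denominator [b]. *)
Lemma powRN_le_of_expn_le (R : realType) (b q C d : nat) (e : R) : 0 <= e ->
  (0 < b)%N -> (b ^ d <= q * C)%N ->
  q%:R `^ (- e) <= C%:R `^ e * b%:R `^ (- (d%:R * e)).
Proof.
move=> e0 b0 bqC.
have : (0 < q * C)%N by apply: leq_trans bqC; rewrite expn_gt0 b0.
rewrite muln_gt0 => /andP[q0 C0].
rewrite !powRN ler_pdivlMr ?powR_gt0 ?ltr0n // ler_pdivrMl ?powR_gt0 ?ltr0n //.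
rewrite powRrM powR_mulrn ?ler0n // -powRM ?ler0n //.
apply: ge0_ler_powR; rewrite ?nnegrE ?exprn_ge0 ?mulr_ge0 ?ler0n //.
by rewrite -natrX -natrM ler_nat.
Qed.

(** The reduced denominator of [p / q] divides [b], so [b p / q] is an integer [k], and [b x - k] is
    [q x - p] scaled by [b / q]. *)
Lemma dist_int_reduced_multiple (R : realType) (x : R) (q b : nat) (p : int) :
  (0 < q)%N -> (q %/ gcdn `|p| q %| b)%N ->
  dist_int (b%:R * x) <= b%:R / q%:R * `|q%:R * x - p%:~R|.
Proof.
move=> q0 qb; have qR : q%:R != 0 :> R by rewrite pnatr_eq0 -lt0n.
have /dvdzP[k kE] : (q%:Z %| b%:Z * p)%Z.
  rewrite dvdzE abszM /= -{1}(divnK (dvdn_gcdr `|p| q)).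
  by rewrite dvdn_mul // dvdn_gcdl.
apply: le_trans (dist_int_le _ k) _.
rewrite -[b%:R / q%:R]ger0_norm ?divr_ge0 // -normrM.
suff -> : b%:R / q%:R * (q%:R * x - p%:~R) = b%:R * x - k%:~R by [].
have kR : b%:R * p%:~R = k%:~R * q%:R :> R.
  by have := congr1 (fun z : int => z%:~R : R) kE; rewrite !rmorphM.
rewrite mulrBr mulrA divfK // mulrAC kR mulfK //.
Qed.

Definition graph_lift (R : realType) (s : nat) (P : 'I_s -> {poly int})
    (x : 'rV[R]_s) : 'rV[R]_(s + s) :=
  row_mx x (\row_(i < s) (map_poly intr (P i)).[x 0 i]).

Lemma projection_simul_approx (R : realType) (s : nat)
    (P : 'I_s -> {poly int}) (x : 'rV[R]_s) (lam : R) : (0 < s)%N ->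
  (forall i, 0 < degree (P i))%N ->
  Num.max ((max_degree P)%:R - 1) 1 < lam ->
  simul_approx (s + s) lam (graph_lift P x) ->
  simul_approx s ((min_degree P)%:R * lam + (min_degree P)%:R - 1) x.
Proof.
move=> s0 P0; rewrite /graph_lift; set d := min_degree P; set d' := max_degree P.
rewrite gt_max => /andP[lamd' lam1] app.
have d0 : (0 < d)%N := min_degree_gt0 s0 P0.
have d'0 : (0 < d')%N := leq_trans (P0 (Ordinal s0)) (degree_le_max P _).
have dR : 1 <= d%:R :> R by rewrite (ler_nat _ 1).
have d'R : 1 <= d'%:R :> R by rewrite (ler_nat _ 1).
apply: simul_approx_suff => eps eps0.
(* The first bound limits the final loss [d e1] in the exponent to [eps]; the second keeps
   [lam - e1] above [d' - 1]. *)
pose e1 := Num.min (eps / d%:R) ((lam - (d'%:R - 1)) / 2).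
have e10 : 0 < e1 by rewrite lt_min !divr_gt0 ?subr_gt0 //; lra.
have e1eps : d%:R * e1 <= eps.
  by rewrite -ler_pdivlMl ?ge_min ?(mulrC _ eps) ?lexx //; lra.
have e1lam : e1 <= (lam - (d'%:R - 1)) / 2 by rewrite ge_min lexx orbT.
(* With [r = q ^ (- (lam - e1))] below, [r / q = q ^ (- e)]. *)
pose e := lam + 1 - e1.
have e0 : 0 <= e by rewrite /e; lra.
pose C := (\prod_i `|lead_coef (P i)| ^ degree (P i))%N.
have C0 : (0 < C)%N.
  apply: prodn_gt0 => i; rewrite expn_gt0 absz_gt0 lead_coef_eq0.
  by have := P0 i; rewrite /degree; case: eqP => // ->; rewrite size_poly0.
have CR : 0 < C%:R :> R by rewrite ltr0n.
exists (C%:R `^ e) => delta delta0.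
(* The interval contains every [x_i] and, once [r <= 1], every [p_i / q]. *)
have [L L0 LP] := poly_family_lipschitz (fun i => map_poly intr (P i))
  (1 + \sum_i `|x 0 i|).
(* Beyond [Q1], [r <= 1] and [C r <= delta]. Beyond [Q2], [(1 + L) r q ^ (d' - 1) <= (1 + L) / (2 +
   L) < 1]. *)
have [Q1 Q1P] := @powRN_eventually_le R (lam - e1)
  (Num.min 1 (delta / C%:R)) ltac:(lra)
  ltac:(by rewrite lt_min ltr01 divr_gt0).
have [Q2 Q2P] := @powRN_eventually_le R (lam - e1 - (d'%:R - 1))
  (2 + L)^-1 ltac:(lra) ltac:(by rewrite invr_gt0; lra).
have [q [Qq /bigmax_leP[_ qP]]] := app _ e10 (maxn Q1 Q2).
have q0 : (0 < q)%N := leq_ltn_trans (leq0n _) Qq.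
move: Qq; rewrite gtn_max => /andP[/Q1P r_small /Q2P q_large].
have qR : 0 < q%:R :> R by rewrite ltr0n.
set r := q%:R `^ (- (lam - e1)) in r_small.
have r0 : 0 < r by rewrite powR_gt0.
have {}qP j : dist_int (q%:R * row_mx x
    (\row_(i < s) (map_poly intr (P i)).[x 0 i]) 0 j) <= r.
  by rewrite /r opprB addrC; exact: qP.
move: r_small; rewrite le_min => /andP[r1 rdelta].
have /choice[p pE] i : exists p : int,
    `|q%:R * x 0 i - p%:~R| <= r.
  have [p pE] := dist_int_attained (q%:R * x 0 i); exists p.
  by rewrite -pE; have := qP (lshift s i); rewrite row_mxEl.
have xp i := distr_frac (x 0 i) (p i) q0.
have xB i : `|x 0 i| <= \sum_i `|x 0 i|.
  by rewrite (bigD1 i) //= lerDl sumr_ge0.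
have qn0 : q%:R != 0 :> R := lt0r_neq0 qR.
have q1 : 1 <= q%:R :> R by rewrite (ler_nat _ 1).
have pB i : `|(p i)%:~R / q%:R : R| <= 1 + \sum_i `|x 0 i|.
  rewrite -[X in `|X|](subrK (x 0 i)).
  apply: le_trans (ler_normD _ _) _; rewrite lerD // distrC xp.
  by rewrite ler_pdivrMr // mul1r; have := pE i; lra.
have denom i : ((q %/ gcdn `|p i| q) ^ degree (P i) %|
    q * `|lead_coef (P i)| ^ degree (P i))%N.
  have [n nE] := dist_int_attained (q%:R * (map_poly intr (P i)).[x 0 i]).
  apply: (@dvdn_reduced_denominator R _ _ _ n q0 (P0 i)).
  have nr : `|q%:R * (map_poly intr (P i)).[x 0 i] - n%:~R| <= r.
    by rewrite -nE; have := qP (rshift s i); rewrite row_mxEr mxE.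
  (* The term [r] comes from rounding [q P_i(x_i)], the term [L r] from replacing [x_i] by
     [p_i / q]. *)
  apply: (@le_lt_trans _ _ ((r + L * r) * q%:R `^ (d'%:R - 1))).
    apply: ler_pM; rewrite ?exprn_ge0 //.
      set A := (map_poly intr (P i)).[_ / _]; set A' := (_.[_]) in nr.
      have -> : q%:R * A - n%:~R = (q%:R * A' - n%:~R) + q%:R * (A - A') by ring.
      apply: le_trans (ler_normD _ _) _; apply: lerD nr _.
      rewrite normrM (ger0_norm (ltW qR)) -ler_pdivlMl //.
      apply: le_trans (LP i _ _ (pB i) _) _; first by have := xB i; lra.
      by rewrite distrC xp [leRHS]mulrCA ler_wpM2l // mulrC ler_wpM2l ?invr_ge0.
    rewrite -powR_mulrn ?ler0n // ler_powR // lerBrDr natr1 prednK //.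
    by rewrite ler_nat degree_le_max.
  rewrite -{1}[r]mul1r -mulrDl -mulrA /r -powRD ?qn0 ?implybT //.
  have -> : - (lam - e1) + (d'%:R - 1) = - (lam - e1 - (d'%:R - 1)) by ring.
  apply: le_lt_trans (ler_wpM2l _ q_large) _; first by lra.
  by rewrite ltr_pdivrMr; lra.
pose b := (\big[lcmn/1%N]_i (q %/ gcdn `|p i| q))%N.
have bi0 i : (0 < q %/ gcdn `|p i| q)%N.
  by rewrite divn_gt0 ?gcdn_gt0 ?q0 ?orbT // dvdn_leq // dvdn_gcdr.
have b0 : (0 < b)%N by rewrite /b; elim/big_ind: _ => // *; rewrite lcmn_gt0; apply/andP.
have bd : (b ^ d <= q * C)%N.
  apply: dvdn_leq; first by rewrite muln_gt0 q0.
  apply: dvdn_biglcm_exp => // i.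
  apply: dvdn_trans (dvdn_exp2l _ (min_degree_le P i)) _.
  apply: dvdn_trans (denom i) _; apply: dvdn_mul => //.
  by rewrite /C (bigD1 i) //= dvdn_mulr.
(* Since [d >= 1], [b <= b ^ d <= q C]. *)
have bq : b%:R / q%:R <= C%:R :> R.
  rewrite ler_pdivrMr // -natrM ler_nat mulnC; apply: leq_trans bd.
  by rewrite -{1}[b]expn1 leq_pexp2l.
exists b => // j.
have bj : (q %/ gcdn `|p j| q %| b)%N by exact: biglcmn_sup.
have main : dist_int (b%:R * x 0 j) <= b%:R / q%:R * r.
  apply: le_trans (dist_int_reduced_multiple (x 0 j) q0 bj) _.
  by rewrite ler_wpM2l // divr_ge0.
split; apply: le_trans main _.
  rewrite -[leRHS](divfK (lt0r_neq0 CR)) mulrC.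
  by apply: ler_pM; rewrite ?divr_ge0 ?(ltW r0).
have -> : b%:R / q%:R * r = b%:R * q%:R `^ (- e).
  rewrite -mulrA -powR_inv1 ?ler0n // /r -powRD ?qn0 ?implybT //.
  by congr (_ * _ `^ _); rewrite /e; ring.
have be := powRN_le_of_expn_le e0 b0 bd.
apply: le_trans (ler_wpM2l _ be) _; first by [].
rewrite mulrCA ler_wpM2l ?powR_ge0 //.
have bR : b%:R != 0 :> R by rewrite pnatr_eq0 -lt0n.
rewrite -{1}[b%:R]powRr1 ?ler0n // -powRD ?bR ?implybT //.
(* The exponents compare because [1 - d e = - (d lam + d - 1) + d e1] and [d e1 <= eps]. *)
apply: ler_powR; first by rewrite (ler_nat _ 1).
by rewrite /e; lra.
Qed.

(** * Hausdorff measure through outer measures, and a Borel-Cantelli argument *)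

Local Open Scope ereal_scope.

(* Giving an infinite weight to the sets of diameter above [delta] turns the
   Hausdorff content into the outer measure generated by a set function, all
   sets being measurable for the sigma-algebra generated by all sets. *)
Definition truncated_gauge (R : realType) (n : nat) (t delta : R)
    (U : set 'rV[R]_n) : \bar R :=
  if U == set0 then 0 else
  if diam U <= delta%:E then poweR (diam U) t else +oo.

Definition hausdorff_outer (R : realType) (n : nat) (t delta : R)
    (A : set 'rV[R]_n) : \bar R :=
  mu_ext (T := g_sigma_algebraType [set: set 'rV[R]_n])
    (@truncated_gauge R n t delta) A.

Lemma measurable_powerset (T : pointedType)
    (A : set (g_sigma_algebraType [set: set T])) : measurable A.
Proof. exact: sub_sigma_algebra. Qed.

Lemma truncated_gauge0 (R : realType) (n : nat) (t delta : R) :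
  truncated_gauge t delta (@set0 'rV[R]_n) = 0.
Proof. by rewrite /truncated_gauge eqxx. Qed.

Lemma truncated_gauge_ge0 (R : realType) (n : nat) (t delta : R)
  (U : set 'rV[R]_n) : 0 <= truncated_gauge t delta U.
Proof.
rewrite /truncated_gauge; case: ifP => // _; case: ifP => _ //.
exact: poweR_ge0.
Qed.

Lemma hausdorff_outer0 (R : realType) (n : nat) (t delta : R) :
  hausdorff_outer t delta (@set0 'rV[R]_n) = 0.
Proof.
exact: (@mu_ext0 _ (g_sigma_algebraType _) R _ (truncated_gauge0 n t delta)
  (@truncated_gauge_ge0 R n t delta)).
Qed.

Lemma hausdorff_outer_ge0 (R : realType) (n : nat) (t delta : R)
  (A : set 'rV[R]_n) : 0 <= hausdorff_outer t delta A.
Proof.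
exact: (@mu_ext_ge0 _ (g_sigma_algebraType _) R _
  (@truncated_gauge_ge0 R n t delta)).
Qed.

Lemma le_hausdorff_outer (R : realType) (n : nat) (t delta : R) :
  {homo @hausdorff_outer R n t delta : A B / A `<=` B >-> A <= B}.
Proof. exact: (@le_mu_ext _ (g_sigma_algebraType _) R). Qed.

Lemma hausdorff_outer_sigma_subadditive (R : realType) (n : nat) (t delta : R) :
  sigma_subadditive (@hausdorff_outer R n t delta).
Proof.
exact: (@mu_ext_sigma_subadditive _ (g_sigma_algebraType _) R _
  (@truncated_gauge_ge0 R n t delta)).
Qed.

HB.instance Definition _ (R : realType) (n : nat) (t delta : R) :=
  isOuterMeasure.Build R 'rV[R]_n (@hausdorff_outer R n t delta)
    (hausdorff_outer0 n t delta) (@hausdorff_outer_ge0 R n t delta)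
    (@le_hausdorff_outer R n t delta)
    (@hausdorff_outer_sigma_subadditive R n t delta).

Lemma diam0 (R : realType) (n : nat) : diam (@set0 'rV[R]_n) = 0.
Proof.
apply/eqP; rewrite eq_le; apply/andP; split.
  by apply: ge_ereal_sup => _ [->//|[x []]].
by apply: ereal_sup_ubound; left.
Qed.

Lemma diam_ge0 (R : realType) (n : nat) (U : set 'rV[R]_n) : 0 <= diam U.
Proof. by apply: ereal_sup_ubound; left. Qed.

Lemma hausdorff_gauge_ge0 (R : realType) (n : nat) (t : R)
  (U : set 'rV[R]_n) : 0 <= hausdorff_gauge t U.
Proof. by rewrite /hausdorff_gauge; case: ifP => // _; exact: poweR_ge0. Qed.

(** A cover with a set of infinite weight bounds nothing; in any other cover all diameters are at
    most [delta], so it competes in the content with the same weights. *)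
Lemma hausdorff_content_le_outer (R : realType) (n : nat) (t delta : R)
    (A : set 'rV[R]_n) : (0 <= delta)%R ->
  hausdorff_content t delta A <= hausdorff_outer t delta A.
Proof.
move=> delta0; apply: le_ereal_inf_tmp => _ [U [_ AU] <-].
have [[i iU]|small] := pselect (exists i, truncated_gauge t delta (U i) = +oo).
  rewrite (nneseries_pinfty _ _ iU) ?leey // => k _.
  exact: truncated_gauge_ge0.
apply: ereal_inf_lbound; exists U; last first.
  apply: eq_eseriesr => i _; rewrite /hausdorff_gauge /truncated_gauge.
  case: ifP => // U0; case: ifP => // big.
  by exfalso; apply: small; exists i; rewrite /truncated_gauge U0 big.
split=> // i; rewrite leNgt; apply/negP => big; apply: small; exists i.
rewrite /truncated_gauge [in X in if _ then _ else X]leNgt big /=.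
by case: eqP => // U0; move: big; rewrite U0 diam0 lte_fin ltNge delta0.
Qed.

Lemma hausdorff_content_ge0 (R : realType) (n : nat) (t delta : R)
  (A : set 'rV[R]_n) : 0 <= hausdorff_content t delta A.
Proof.
apply: le_ereal_inf_tmp => _ [U _ <-]; apply: nneseries_ge0 => i _ _.
exact: hausdorff_gauge_ge0.
Qed.

Lemma hausdorff_outer_le (R : realType) (n : nat) (t delta r : R)
    (U : set 'rV[R]_n) : (0 <= t)%R -> (r <= delta)%R -> diam U <= r%:E ->
  hausdorff_outer t delta U <= (r `^ t)%:E.
Proof.
move=> t0 rdelta Ur; have r0 : (0 <= r)%R.
  by rewrite -lee_fin; exact: le_trans (diam_ge0 U) Ur.
apply: (@le_trans _ _ (truncated_gauge t delta U)).
  (* The cover by [U] alone, padded with empty sets of weight 0. *)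
  pose F (k : nat) : set 'rV[R]_n := if k is 0%N then U else set0.
  apply: ereal_inf_lbound; exists F.
    split=> [k|x Ux]; first exact: measurable_powerset.
    by exists 0%N.
  rewrite nneseries_recl // => [|k _]; last exact: truncated_gauge_ge0.
  rewrite eseries0 ?adde0 // => -[//|k] _ _.
  exact: truncated_gauge0.
rewrite /truncated_gauge (le_trans Ur) ?lee_fin //.
case: ifP => _; first by rewrite lee_fin powR_ge0.
rewrite -poweR_EFin; apply: gt0_ler_poweR => //.
- by rewrite in_itv /= diam_ge0 leey.
- by rewrite in_itv /= lee_fin r0 leey.
Qed.

Lemma hausdorff_outer_bigU (R : realType) (n : nat) (t delta r : R)
    (I : finType) (V : I -> set 'rV[R]_n) : (0 <= t)%R -> (r <= delta)%R ->
  (forall i, diam (V i) <= r%:E) ->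
  hausdorff_outer t delta (\big[setU/set0]_i V i) <= (#|I|%:R * r `^ t)%:E.
Proof.
move=> t0 rdelta Vr; rewrite -sum1_card natr_sum mulr_suml -sumEFin.
elim/big_rec2: _ => [|i x A _ IH]; first by rewrite outer_measure0.
apply: le_trans (outer_measureU2 _ _ _) _; rewrite leeD //.
by rewrite mul1r hausdorff_outer_le.
Qed.

Lemma nneseries_geometric_lty (R : realType) (C z : R) : (0 <= z < 1)%R ->
  \sum_(k <oo) (C * z ^+ k)%:E < +oo.
Proof.
move=> /andP[z0 z1].
have -> : (fun m => \sum_(0 <= k < m) (C * z ^+ k)%:E) =
    EFin \o series (geometric C z).
  by apply/funext => m; rewrite /= sumEFin.
rewrite EFin_lim ?ltry //; apply: is_cvg_geometric_series.
by rewrite ger0_norm.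
Qed.

(* Borel-Cantelli: [A] is contained in the upper limit of the finite families
   [V k], whose total weights decay geometrically. *)
Lemma hausdorff_outer_limsup_eq0 (R : realType) (n : nat) (t delta C z : R)
    (A : set 'rV[R]_n) (I : nat -> finType) (V : forall k, I k -> set 'rV[R]_n)
    (r : nat -> R) (k0 : nat) : (0 <= t)%R -> (0 <= C)%R -> (0 <= z < 1)%R ->
  (forall k, (k0 <= k)%N -> (r k <= delta)%R) ->
  (forall k (i : I k), diam (V k i) <= (r k)%:E) ->
  (forall k, (#|I k|%:R * r k `^ t <= C * z ^+ k)%R) ->
  (forall N x, A x -> exists k, (N <= k)%N /\ exists i : I k, V k i x) ->
  hausdorff_outer t delta A = 0.
Proof.
move=> t0 C0 z01 rdelta Vr weight cover.
have [z0 _] := andP z01.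
have Cz0 k : 0 <= (C * z ^+ k)%:E by rewrite lee_fin mulr_ge0 // exprn_ge0.
have tail := nneseries_tail_cvg (nneseries_geometric_lty C z01)
  (fun k _ => Cz0 k).
apply/eqP; rewrite eq_le outer_measure_ge0 andbT -(cvg_lim _ tail) //.
apply: lime_ge; first exact: cvgP tail.
exists k0 => // N /= k0N.
pose F k := if (k0 <= k)%N then \big[setU/set0]_i V k i else set0.
apply: (@le_trans _ _ (hausdorff_outer t delta (\bigcup_(k in ~` `I_N) F k))).
  apply: le_outer_measure => x /(cover N)[k [Nk [i ikx]]].
  exists k; first by apply/negP; rewrite -leqNgt.
  by rewrite /F (leq_trans k0N Nk) (bigD1 i) //=; left.
apply: le_trans (outer_measure_sigma_subadditive_tail _ N F) _.
apply: lee_nneseries => [k _ _|k _]; first exact: outer_measure_ge0.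
rewrite /F; case: ifP => [k0k|_]; last by rewrite outer_measure0.
apply: le_trans (hausdorff_outer_bigU t0 (rdelta k k0k) (Vr k)) _.
by rewrite lee_fin.
Qed.

Lemma hausdorff_measure_eq0 (R : realType) (n : nat) (t : R)
    (A : set 'rV[R]_n) :
  (forall delta, (0 < delta)%R -> hausdorff_outer t delta A = 0) ->
  hausdorff_measure t A = 0.
Proof.
move=> A0; have content0 delta : (0 < delta)%R -> hausdorff_content t delta A = 0.
  move=> d0; apply/eqP; rewrite eq_le hausdorff_content_ge0 andbT -(A0 _ d0).
  exact/hausdorff_content_le_outer/ltW.
apply/eqP; rewrite eq_le; apply/andP; split.
  by apply: ge_ereal_sup => _ [delta d0 <-]; rewrite content0.
(* Any positive [delta] shows that the supremum is at least 0; here it is 1. *)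
by apply: ereal_sup_ubound; exists 1%R; [rewrite /= ltr01|rewrite content0].
Qed.

Lemma hausdorff_dim_le (R : realType) (n : nat) (t0 : R) (A : set 'rV[R]_n) :
  (0 <= t0)%R -> (forall t, (t0 < t)%R -> hausdorff_measure t A = 0) ->
  hausdorff_dim A <= t0%:E.
Proof.
move=> t00 A0; apply/lee_addgt0Pr => e e0.
apply: ereal_inf_lbound; exists (t0 + e)%R => //.
by split; [rewrite addr_ge0 // ltW|rewrite A0 // ltrDl].
Qed.

(** The sharp factor is the square root of [n]; the cruder [n] suffices for covering estimates. *)
Lemma diam_le (R : realType) (n : nat) (c : R) (U : set 'rV[R]_n) :
  (0 <= c)%R ->
  (forall x y, U x -> U y -> forall j, (`|x 0 j - y 0 j| <= c)%R) ->
  diam U <= (n%:R * c)%:E.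
Proof.
move=> c0 Uc; apply: ge_ereal_sup => _ [->|[x Ux [y Uy <-]]].
  by rewrite lee_fin mulr_ge0.
rewrite lee_fin /eucl_dist -[leRHS]ger0_norm ?mulr_ge0 // -sqrtr_sqr.
apply: ler_wsqrtr; apply: (@le_trans _ _ (n%:R * c ^+ 2)%R).
  rewrite mulr_natl -[X in (_ *+ X)%R]card_ord -sumr_const.
  apply: ler_sum => j _; rewrite -real_normK ?num_real //.
  by rewrite ler_sqr ?nnegrE // Uc.
rewrite exprMn ler_wpM2r ?exprn_ge0 // -natrX ler_nat.
by case: (n) => // m; rewrite leq_pmulr.
Qed.

Local Close Scope ereal_scope.

(** * Covering the graph over well approximable points *)

(** Counts denominators below [2 ^ (k + 1)] with [s] numerators each; the 6 comes from
    [4 (n + 1) 2 ^ k + 1 <= 6 (n + 1) 2 ^ k]. *)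
Lemma card_ball_index_le (s n k : nat) :
  (#|{: 'I_(2 ^ k.+1) * {ffun 'I_s -> 'I_(n.+1 * 2 ^ k.+1).*2.+1}}|
   <= 2 * (6 * n.+1) ^ s * (2 ^ k) ^ s.+1)%N.
Proof.
rewrite card_prod card_ffun !card_ord.
have -> : (2 * (6 * n.+1) ^ s * (2 ^ k) ^ s.+1 =
    2 ^ k.+1 * (6 * n.+1 * 2 ^ k) ^ s)%N.
  by rewrite [in RHS]expnMn !expnS; ring.
rewrite leq_mul2l; apply/orP; right.
case: s => // s; rewrite leq_exp2r //.
by rewrite expnS; have := expn_gt0 2 k; nia.
Qed.

Lemma absz_shift (p : int) (h : nat) : (`|p| <= h)%N ->
  (`|(p + h%:Z)%R| < h.*2.+1)%N /\ `|p + h%:Z| = p + h%:Z.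
Proof. by lia. Qed.

(** Block [k] has [O(2 ^ (k (s + 1)))] rational points, whose balls lift to sets of diameter
    [O(2 ^ (- k nu))]; the total weight [O(2 ^ (- k beta))] is summable. *)
Lemma hausdorff_outer_graph_box_eq0 (R : realType) (s : nat)
    (P : 'I_s -> {poly int}) (mu t delta : R) (n : nat) :
  0 < mu -> (s%:R + 1) / (mu + 1) < t -> 0 < delta ->
  hausdorff_outer t delta [set graph_lift P x | x in
    [set x : 'rV[R]_s | simul_approx s mu x /\
                        forall j, `|x 0 j| <= n%:R]] = 0%E.
Proof.
move=> mu0 mut delta0.
have t0 : 0 < t by apply: le_lt_trans mut; rewrite divr_ge0 //; lra.
have {}mut : s%:R + 1 < t * (mu + 1) by rewrite -ltr_pdivrMr; lra.
(* The second bound spends at most half of the slack in [mut], so [beta > 0]; [eps <= mu] gives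
   [q ^ (- mu + eps) <= 1]. *)
pose eps := Num.min mu ((t * (mu + 1) - (s%:R + 1)) / (2 * t)).
have eps0 : 0 < eps by rewrite lt_min mu0 divr_gt0 ?mulr_gt0 ?subr_gt0.
have epsmu : eps <= mu by rewrite ge_min lexx.
have epst : t * eps <= (t * (mu + 1) - (s%:R + 1)) / 2.
  have : eps <= (t * (mu + 1) - (s%:R + 1)) / (2 * t).
    by rewrite ge_min lexx orbT.
  by rewrite invfM mulrA ler_pdivlMr // mulrC.
pose nu := mu + 1 - eps; pose beta := t * nu - (s%:R + 1).
have nu0 : 0 < nu by rewrite /nu; lra.
have beta0 : 0 < beta by rewrite /beta /nu; lra.
have [L L0 LP] :=
  @poly_family_lipschitz R _ (fun i => map_poly intr (P i)) n%:R.
pose rho k : R := (2 ^ k)%:R `^ (- nu).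
have rho0 k : 0 <= rho k := powR_ge0 _ _.
(* Dyadic blocks: the index (q, f) of block k stands for the rational point with
   denominator q and numerators f_j - H k, where H k bounds their size. *)
pose H k := (n.+1 * 2 ^ k.+1)%N.
pose I k : finType := ('I_(2 ^ k.+1) * {ffun 'I_s -> 'I_(H k).*2.+1})%type.
pose V k (i : I k) := [set graph_lift P x | x in [set x : 'rV[R]_s |
  forall j, `|x 0 j| <= n%:R /\
    `|x 0 j - ((i.2 j)%:R - (H k)%:R) / i.1%:R| <= rho k]].
(* The factor [s + s] comes from [diam_le], 2 from radius to diameter, and [1 + L] covers both
   halves of the lift. *)
pose K := (s + s)%:R * ((1 + L) * 2).
have K0 : 0 <= K by rewrite !mulr_ge0 // addr_ge0.
have [k0 k0P] := @powRN_eventually_le R nu (delta / (K + 1)) nu0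
  ltac:(by rewrite divr_gt0 // ltr_wpDl).
have pow2 k : 0 < (2 ^ k)%:R :> R by rewrite ltr0n expn_gt0.
apply: (@hausdorff_outer_limsup_eq0 R (s + s) t delta
  (2 * (6 * n.+1)%:R ^+ s * K `^ t) (2 `^ (- beta)) _ I V
  (fun k => K * rho k) k0).
- exact: ltW.
- by rewrite !mulr_ge0 ?exprn_ge0 ?powR_ge0.
- rewrite powR_ge0 powRN invf_lt1 ?powR_gt0 //.
  apply: (@le_lt_trans _ _ (1 `^ beta)); first by rewrite powR1.
  by apply: gt0_ltr_powR; rewrite ?nnegrE // ltr1n.
- move=> k k0k; have /k0P : (k0 < 2 ^ k)%N.
    by apply: leq_ltn_trans k0k _; exact: ltn_expl.
  rewrite -/(rho k) => rhok.
  apply: le_trans (ler_wpM2l K0 rhok) _.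
  by rewrite mulrA ler_pdivrMr; nra.
- move=> k i; rewrite /K -!mulrA; apply: diam_le.
    by rewrite !mulr_ge0 // addr_ge0.
  move=> _ _ [x xi <-] [y yi <-].
  have xy j : `|x 0 j - y 0 j| <= 2 * rho k.
    pose a : R := ((i.2 j)%:R - (H k)%:R) / i.1%:R.
    apply: le_trans (ler_distD a _ _) _; rewrite [`|a - _|]distrC.
    by have := (xi j).2; have := (yi j).2; rewrite -/a; lra.
  move=> j; rewrite /graph_lift; case: (split_ordP j) => i' ->.
    rewrite !row_mxEl; apply: le_trans (xy i') _.
    by rewrite ler_peMl ?mulr_ge0 // lerDl.
  rewrite !row_mxEr !mxE; apply: le_trans (LP _ _ _ (xi i').1 (yi i').1) _.
  by apply: ler_pM => //; lra.
- move=> k; have card : (#|I k| <= 2 * (6 * n.+1) ^ s * (2 ^ k) ^ s.+1)%N.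
    exact: card_ball_index_le.
  have {card} : #|I k|%:R <= 2 * (6 * n.+1)%:R ^+ s * (2 ^ k)%:R ^+ s.+1 :> R.
    by rewrite -!natrX -!natrM ler_nat.
  rewrite powRM // => card.
  apply: le_trans (ler_wpM2r _ card) _; first by rewrite mulr_ge0 ?powR_ge0.
  rewrite -!mulrA ler_wpM2l // ler_wpM2l ?exprn_ge0 // mulrCA.
  rewrite ler_wpM2l ?powR_ge0 // /rho -powR_mulrn ?ler0n // -powRrM -powRD;
    last by rewrite (lt0r_neq0 (pow2 k)) implybT.
  have -> : s.+1%:R + - nu * t = - beta by rewrite /beta -natr1; ring.
  by rewrite natrX -!powR_mulrn ?powR_ge0 // -!powRrM mulrC.
move=> N _ [x [xmu xn] <-].
have [q [Nq /bigmax_leP[_ qx]]] := xmu _ eps0 (2 ^ N)%N.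
have q0 : (0 < q)%N := leq_ltn_trans (leq0n _) Nq.
have qR : 0 < q%:R :> R by rewrite ltr0n.
have qn0 : q%:R != 0 :> R := lt0r_neq0 qR.
exists (trunc_log 2 q); split; first by rewrite trunc_log_max // ltnW.
set k := trunc_log 2 q.
have /andP[kq qk] := trunc_log_bounds (isT : 1 < 2)%N q0.
have /choice[p pE] j : exists p : int,
    `|q%:R * x 0 j - p%:~R| <= q%:R `^ (- mu + eps).
  have [p pE] := dist_int_attained (q%:R * x 0 j); exists p.
  by rewrite -pE; exact: qx.
(* Here [|p_j| <= q |x_j| + 1 <= (n + 1) q], and [q < 2 ^ (k + 1)]. *)
have pH j : (`|p j| <= H k)%N.
  have qR1 : 1 <= q%:R :> R by rewrite (ler_nat _ 1).
  have pq : `|p j|%:~R <= n.+1%:R * q%:R :> R.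
    rewrite intr_norm -natr1 mulrDl mul1r.
    rewrite -[X in `|X|](subrK (q%:R * x 0 j)).
    rewrite addrC; apply: le_trans (ler_normD _ _) _; apply: lerD.
      by rewrite normrM normr_nat mulrC ler_wpM2r.
    rewrite distrC; apply: le_trans (pE j) (le_trans _ qR1).
    apply: (@le_trans _ _ (q%:R `^ 0)); last by rewrite powRr0.
    by apply: ler_powR => //; lra.
  have {}pq : (`|p j| <= n.+1 * q)%N.
    by rewrite -(ler_nat R) natrM natr_absz.
  by apply: leq_trans pq _; rewrite leq_mul2l ltnW.
pose f : {ffun 'I_s -> 'I_(H k).*2.+1} :=
  [ffun j => inord `|(p j + (H k)%:Z)%R|%N].
have fE j : (f j)%:R - (H k)%:R = (p j)%:~R :> R.
  have [ltH pHE] := absz_shift (pH j).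
  by rewrite ffunE inordK // natr_absz pHE rmorphD /= addrK.
exists (Ordinal qk, f); exists x => // j; split; first exact: xn.
rewrite fE /= distr_frac //.
apply: (@le_trans _ _ (q%:R `^ (- nu))).
  have -> : - nu = (- mu + eps) + (- 1) by rewrite /nu; ring.
  by rewrite powRD ?qn0 ?implybT // powR_inv1 // ler_wpM2r ?invr_ge0.
rewrite /rho !powRN lef_pV2 ?posrE ?powR_gt0 //.
by apply: ge0_ler_powR; rewrite ?nnegrE ?ler_nat // ltW.
Qed.

(** The Lipschitz constant of the lift depends on the box, so the graph is exhausted by countably
    many boxes. *)
Lemma hausdorff_outer_graph_eq0 (R : realType) (s : nat)
    (P : 'I_s -> {poly int}) (mu t delta : R) :
  0 < mu -> (s%:R + 1) / (mu + 1) < t -> 0 < delta ->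
  hausdorff_outer t delta (graph_lift P @` simul_approx s mu) = 0%E.
Proof.
move=> mu0 mut delta0; apply/eqP; rewrite eq_le outer_measure_ge0 andbT.
pose B (n : nat) := [set graph_lift P x | x in
  [set x : 'rV[R]_s | simul_approx s mu x /\ forall j, `|x 0 j| <= n%:R]].
apply: (@le_trans _ _ (hausdorff_outer t delta (\bigcup_n B n))).
  apply: le_outer_measure => _ [x xmu <-].
  exists (Num.truncn (\sum_j `|x 0 j|)).+1 => //; exists x => //; split=> // j.
  apply/ltW/(le_lt_trans _ (truncnS_gt _)).
  by rewrite (bigD1 j) //= lerDl sumr_ge0.
apply: le_trans (outer_measure_sigma_subadditive _ B) _.
by rewrite eseries0 // => n _ _; exact: hausdorff_outer_graph_box_eq0.
Qed.

(** * The inclusion and the dimension bound *)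

Theorem theorem2p7 (R : realType) (s : nat) (hs : (1 <= s)%N)
    (P : 'I_s -> {poly int}) (hP : forall i : 'I_s, (1 <= degree (P i))%N) :
  let d := min_degree P in
  let d' := max_degree P in
  let M := poly_graph R P in
  (forall lam : R, Num.max (d'%:R - 1) 1 < lam ->
     [set lsubmx z | z in simul_approx (s + s) lam `&` M]
       `<=` simul_approx s (d%:R * lam + d%:R - 1)) /\
  (forall lam : R, Num.max (d'%:R - 1) 1 < lam ->
     (hausdorff_dim (simul_approx (s + s) lam `&` M)
       <= ((s%:R + 1) / (d%:R * (lam + 1)))%:E)%E).
Proof.
move=> d d' M; have proj lam : Num.max (d'%:R - 1) 1 < lam ->
    simul_approx (s + s) lam `&` M `<=`
    graph_lift P @` simul_approx s (d%:R * lam + d%:R - 1).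
  move=> lamd _ [/[swap] -[x _ <-] xlam]; exists x => //.
  exact: projection_simul_approx xlam.
split=> lam lamd.
  by move=> _ [z /(proj _ lamd)[x xmu <-] <-]; rewrite row_mxKl.
have d1 : 1 <= d%:R :> R by rewrite (ler_nat _ 1) min_degree_gt0.
have lam1 : 1 < lam by move: lamd; rewrite gt_max => /andP[].
apply: hausdorff_dim_le => [|t tlam].
  by rewrite divr_ge0 ?mulr_ge0 //; lra.
apply: hausdorff_measure_eq0 => delta delta0.
apply/eqP; rewrite eq_le outer_measure_ge0 andbT.
(* For [mu = d lam + d - 1] one has [mu + 1 = d (lam + 1)], which yields the stated exponent. *)
rewrite -(@hausdorff_outer_graph_eq0 R s P (d%:R * lam + d%:R - 1) t delta) //.
- exact/le_outer_measure/proj.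
- by nra.
- by have -> : d%:R * lam + d%:R - 1 + 1 = d%:R * (lam + 1) by ring.
Qed.
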